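(* Let $R$ be a commutative ring and let $A$ be a free Frobenius $R$-algebra with a Frobenius system $(\theta,x_i,y_i)_{1\le i\le n}$ such that $\{x_i\}_{i=1}^n$ is a basis of the free $R$-module $A$. Let $\mu$ be the Nakayama automorphism of $A$, let $\operatorname{tr}:A\to R$ be the Hattori-Stallings trace map, and put $\omega=\sum_{i=1}^n\mu(x_i)y_i$. Then $$\operatorname{tr}=\theta\cdot\omega\qquad\text{and}\qquad d(A,R;\operatorname{tr})=_{R^\times}\operatorname{nr}(\omega).$$ In particular, $\omega$ is a $\mu$-normal element of $A$, that is, $\mu(a)\omega=\omega a$ for every $a\in A$.
   Context: For a commutative ring $R$ and an $R$-algebra $A$, $\operatorname{Hom}_R(A,R)$ is an $A$-$A$-bimodule via $(a\cdot f\cdot b)(x)=f(bxa)$. $A$ is a Frobenius $R$-algebra if $A$ is a finitely generated projective $R$-module and there is an $R$-$A$-bimodule isomorphism $\Theta:A\to\operatorname{Hom}_R(A,R)$; it is a free Frobenius $R$-algebra if moreover $A$ is a free $R$-module. A Frobenius system $(\theta,x_i,y_i)$ consists of an $R$-linear map $\theta:A\to R$ and elements $x_1,\dots,x_n,y_1,\dots,y_n\in A$ such that $\sum_i x_i\theta(y_ia)=a=\sum_i\theta(ax_i)y_i$ for all $a\in A$; then $\Theta(a)=\theta\cdot a$ (so $(\theta\cdot a)(x)=\theta(ax)$) is such an isomorphism. The Nakayama automorphism (associated with $\theta$) is the automorphism $\mu$ of $A$ with $a\cdot\theta=\theta\cdot\mu(a)$, i.e. $\theta(xa)=\theta(\mu(a)x)$,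 for all $a,x\in A$; equivalently $\Theta:{}^\mu A\to\operatorname{Hom}_R(A,R)$ is an $A$-$A$-bimodule isomorphism, where ${}^\mu A$ is $A$ with action $a\cdot m\cdot b=\mu(a)mb$. For $A$ free of finite rank over $R$: the Hattori-Stallings trace $\operatorname{tr}(a)$ is the trace of left multiplication $a_L\in\operatorname{End}_R(A)$; the norm $\operatorname{nr}(a)$ is the determinant of $a_L$; and $d(A,R;\operatorname{tr})=\det([\operatorname{tr}(z_iz_j)]_{i,j})$ for any $R$-basis $\{z_i\}$ of $A$, well defined up to $R^\times$. $x=_{R^\times}y$ means $x=uy$ for some unit $u\in R^\times$. The element $\omega$ is called a different of $A$ over $R$. *)

(* Defs.v *)
From HB Require Import structures.
From mathcomp Require Import all_boot all_algebra.

Set Implicit Arguments.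
Unset Strict Implicit.
Unset Printing Implicit Defensive.

Import GRing.Theory.
Local Open Scope ring_scope.

Section Basis.
Variables (R : comPzRingType) (V : lmodType R).

Definition is_basis (n : nat) (b : 'I_n -> V) : Prop :=
  (forall v : V, exists c : 'rV[R]_n, v = \sum_(i < n) c 0 i *: b i) /\
  (forall c : 'rV[R]_n, \sum_(i < n) c 0 i *: b i = 0 -> c = 0).

Lemma basis_coord_ex (n : nat) (b : 'I_n -> V) (hb : is_basis b) (v : V) :
  exists c : 'rV[R]_n, v == \sum_(i < n) c 0 i *: b i.
Proof. by case: hb => /(_ v) [c ->] _; exists c. Qed.

Definition basis_coord (n : nat) (b : 'I_n -> V) (hb : is_basis b) (v : V) :
  'rV[R]_n := xchoose (basis_coord_ex hb v).

Lemma basis_coordE (n : nat) (b : 'I_n -> V) (hb : is_basis b) (v : V) :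
  v = \sum_(i < n) basis_coord hb v 0 i *: b i.
Proof. exact/eqP/(xchooseP (basis_coord_ex hb v)). Qed.

(* Column convention: f (b j) = \sum_i (end_mx hb f i j) *: b i. *)
Definition end_mx (n : nat) (b : 'I_n -> V) (hb : is_basis b) (f : V -> V) :
  'M[R]_n := \matrix_(i < n, j < n) basis_coord hb (f (b j)) 0 i.

End Basis.

Section Frobenius.
Variables (R : comPzRingType) (A : algType R).

(* The two A-actions on Hom_R(A, R): a.f and f.a. *)
Definition form_mull (a : A) (f : A -> R) : A -> R := fun x => f (x * a).
Definition form_mulr (f : A -> R) (a : A) : A -> R := fun x => f (a * x).

(* R-A-bimodule isomorphisms A -> Hom_R(A, R); linear forms are compared
   pointwise. *)
Definition frobenius_iso (Theta : A -> {scalar A}) : Prop :=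
  [/\ forall (r : R) (a b : A),
        Theta (r *: a + b) =1 (fun x => r * Theta a x + Theta b x),
      forall a b : A, Theta (a * b) =1 form_mulr (Theta a) b,
      forall a b : A, Theta a =1 Theta b -> a = b
    & forall f : {scalar A}, exists a : A, Theta a =1 f].

(* Having a finite basis subsumes being finitely generated projective. *)
Definition free_frobenius : Prop :=
  (exists (n : nat) (b : 'I_n -> A), is_basis b) /\
  (exists Theta : A -> {scalar A}, frobenius_iso Theta).

Definition frobenius_system (theta : {scalar A}) (n : nat) (x y : 'I_n -> A) :
    Prop :=
  forall a : A,
    \sum_(i < n) theta (y i * a) *: x i = a /\
    \sum_(i < n) theta (a * x i) *: y i = a.

Definition is_nakayama (theta : {scalar A}) (mu : {lrmorphism A -> A}) : Prop :=
  bijective mu /\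
  forall a : A, form_mull a theta =1 form_mulr theta (mu a).

Definition hs_trace (n : nat) (b : 'I_n -> A) (hb : is_basis b) (a : A) : R :=
  \tr (end_mx hb (fun v => a * v)).

Definition alg_norm (n : nat) (b : 'I_n -> A) (hb : is_basis b) (a : A) : R :=
  \det (end_mx hb (fun v => a * v)).

Definition discriminant (t : A -> R) (n : nat) (z : 'I_n -> A) : R :=
  \det (\matrix_(i < n, j < n) t (z i * z j)).

Definition normal_element (mu : A -> A) (w : A) : Prop :=
  forall a : A, mu a * w = w * a.

End Frobenius.

Definition eq_up_to_unit (R : comPzRingType) (r s : R) : Prop :=
  exists2 u : R, (exists v : R, v * u = 1) & r = u * s.

(* Main.v *)
Require Import Defs.
From HB Require Import structures.
From mathcomp Require Import all_boot all_algebra.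
Import GRing.Theory.
Local Open Scope ring_scope.

(** The dual basis formula computes [tr a] from any finite family [x i] with
    coordinate forms [theta (y i * _)], giving
    [tr a = \sum_i theta (y i * a * x i) = theta (omega * a)] by the defining
    property of [mu].  Normality then follows from [tr (a * v) = tr (v * a)] and
    the nondegeneracy of [theta].  Finally the matrix of [tr (z i * z j)] is the
    transposed matrix of left multiplication by [omega] times the Gram matrix
    of [theta], which is invertible by the Frobenius system. *)

(* Sylvester's identity; it yields basis independence of determinants without
   first knowing that two bases have the same size. *)
Lemma det_1D_mulmxC (R : comPzRingType) (m n : nat) (X : 'M[R]_(m, n))
    (Y : 'M[R]_(n, m)) : \det (1%:M + X *m Y) = \det (1%:M + Y *m X).
Proof.
(* The products in [HR] and [HL] share their right factor and have unitriangular left factors, so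
   both determinants equal that of the shared factor. *)
have HR : block_mx 1%:M X 0 1%:M *m block_mx 1%:M (- X) Y 1%:M =
    block_mx (1%:M + X *m Y) 0 Y 1%:M.
  by rewrite mulmx_block !mul1mx !mulmx1 !mul0mx !add0r addNr.
have HL : block_mx 1%:M 0 (- Y) 1%:M *m block_mx 1%:M (- X) Y 1%:M =
    block_mx 1%:M (- X) 0 (1%:M + Y *m X).
  rewrite mulmx_block !mul1mx !mulmx1 !mul0mx !addr0 mulNmx mulmxN opprK.
  by rewrite addNr [X in block_mx _ _ _ X]addrC.
move: (congr1 determinant HR) (congr1 determinant HL).
by rewrite !det_mulmx !(det_ublock, det_lblock) !det1 !mul1r !mulr1 => <- <-.
Qed.

Section Coordinates.
Context {R : comPzRingType} {V : lmodType R}.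

Lemma basis_coord_unique {n : nat} {b : 'I_n -> V} (hb : is_basis b) (v : V)
    (c : 'rV[R]_n) : v = \sum_(i < n) c 0 i *: b i -> basis_coord hb v = c.
Proof.
move=> vE; apply/eqP; rewrite -subr_eq0; apply/eqP; apply: hb.2.
under eq_bigr do rewrite !mxE scalerBl.
by rewrite sumrB -vE -basis_coordE subrr.
Qed.

Lemma basis_coord_sum {n : nat} {b : 'I_n -> V} (hb : is_basis b) (k : nat)
    (c : 'I_k -> R) (v : 'I_k -> V) :
  basis_coord hb (\sum_(l < k) c l *: v l) =
  \sum_(l < k) c l *: basis_coord hb (v l).
Proof.
apply: basis_coord_unique.
under [RHS]eq_bigr => i _ do rewrite summxE scaler_suml.
rewrite exchange_big; apply: eq_bigr => l _ /=.
rewrite {1}(basis_coordE hb (v l)) scaler_sumr.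
by apply: eq_bigr => i _; rewrite mxE scalerA.
Qed.

Lemma basis_coord_basis {n : nat} {b : 'I_n -> V} (hb : is_basis b) (j : 'I_n) :
  basis_coord hb (b j) = delta_mx 0 j.
Proof.
apply: basis_coord_unique.
rewrite (bigD1 j) //= mxE !eqxx scale1r big1 ?addr0 // => i /negPf neq_ij.
by rewrite mxE eqxx neq_ij scale0r.
Qed.

(* Column convention, as for [end_mx]. *)
Definition hom_mx {n k : nat} {b : 'I_n -> V} {z : 'I_k -> V}
    (hb : is_basis b) (hz : is_basis z) (f : V -> V) : 'M[R]_(k, n) :=
  \matrix_(i < k, j < n) basis_coord hz (f (b j)) 0 i.

Lemma hom_mx_id {n : nat} {b : 'I_n -> V} (hb : is_basis b) :
  hom_mx hb hb id = 1%:M.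
Proof. by apply/matrixP => i j; rewrite !mxE basis_coord_basis mxE eqxx. Qed.

Lemma hom_mx_comp {n k l : nat} {b : 'I_n -> V} {z : 'I_k -> V}
    {w : 'I_l -> V} (hb : is_basis b) (hz : is_basis z) (hw : is_basis w)
    (f : {linear V -> V}) (g : V -> V) :
  hom_mx hb hw (f \o g) = hom_mx hz hw f *m hom_mx hb hz g.
Proof.
apply/matrixP => i j; rewrite !mxE /= {1}(basis_coordE hz (g (b j))) linear_sum.
under [X in basis_coord _ X]eq_bigr do rewrite linearZ_LR.
rewrite basis_coord_sum summxE.
by apply: eq_bigr => p _; rewrite !mxE mulrC.
Qed.

Lemma det_end_mx {n k : nat} {b : 'I_n -> V} {z : 'I_k -> V}
    (hb : is_basis b) (hz : is_basis z) (f : {linear V -> V}) :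
  \det (end_mx hb f) = \det (end_mx hz f).
Proof.
pose P := hom_mx hz hb idfun; pose Q := hom_mx hb hz idfun.
have PQ1 : P *m Q = 1%:M by rewrite -hom_mx_comp hom_mx_id.
have QP1 : Q *m P = 1%:M by rewrite -hom_mx_comp hom_mx_id.
have bE : end_mx hb f = P *m (end_mx hz f *m Q).
  by rewrite -!(hom_mx_comp _ hz).
(* [P] and [Q] may be rectangular a priori. With [end_mx hz f = 1 + N], the product [P (1 + N) Q]
   becomes [1 + P N Q], and Sylvester's identity moves [P] to the right of [Q]. *)
rewrite bE -[end_mx hz f](subrK 1%:M) mulmxDl mul1mx mulmxDr PQ1 addrC.
by rewrite det_1D_mulmxC -mulmxA QP1 mulmx1 addrC.
Qed.

(** Expanding [f (b j)] along [x] and swapping the sums leaves the [b]-coordinates of [x i], which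
    reassemble [x i] by linearity of [c i] and [f]. *)
Lemma trace_end_mx_dual {m n : nat} {b : 'I_m -> V} (hb : is_basis b)
    {x : 'I_n -> V} {c : 'I_n -> {scalar V}}
    (xc : forall v, v = \sum_(i < n) c i v *: x i) (f : {linear V -> V}) :
  \tr (end_mx hb f) = \sum_(i < n) c i (f (x i)).
Proof.
rewrite /mxtrace.
under eq_bigr => j _ do rewrite mxE [f (b j)]xc basis_coord_sum summxE.
rewrite exchange_big; apply: eq_bigr => i _ /=.
rewrite {2}(basis_coordE hb (x i)) !linear_sum.
by apply: eq_bigr => j _; rewrite !linearZ mxE mulrC.
Qed.

End Coordinates.

Lemma hs_traceC {R : comPzRingType} {A : algType R} {m : nat} {b : 'I_m -> A}
    (hb : is_basis b) (a c : A) : hs_trace hb (a * c) = hs_trace hb (c * a).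
Proof.
have mulE (u v : A) : end_mx hb (fun w => u * v * w) =
    end_mx hb (fun w => u * w) *m end_mx hb (fun w => v * w).
  rewrite -[RHS](hom_mx_comp hb hb hb (u \*o idfun)).
  by apply/matrixP => i j; rewrite !mxE /= mulrA.
by rewrite /hs_trace !mulE mxtrace_mulC.
Qed.

Section FrobeniusSystem.
Context {R : comPzRingType} {A : algType R} {theta : {scalar A}} {n : nat}.
Context {x y : 'I_n -> A}.
Context (hsys : frobenius_system theta x y).

(** The values [theta (a * x i)] are the coefficients that rebuild [a] from the [y i]. *)
Lemma frobenius_form_inj (a c : A) :
  (forall v, theta (a * v) = theta (c * v)) -> a = c.
Proof.
move=> eq_ac; rewrite -(hsys a).2 -[RHS](hsys c).2.
by apply: eq_bigr => i _; rewrite eq_ac.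
Qed.

Lemma det_gram_unit {k : nat} {z : 'I_k -> A} (hz : is_basis z) :
  exists v : R, v * \det (\matrix_(i < k, j < k) theta (z i * z j)) = 1.
Proof.
pose G := \matrix_(i < k, j < k) theta (z i * z j).
pose C := \matrix_(l < n, i < k) basis_coord hz (y l) 0 i.
pose D := \matrix_(i < k, l < n) basis_coord hz (x l) 0 i.
(* [D *m C] inverts [G]: column [j] of [C *m G] holds the coefficients [theta (y l * z j)] of [z j]
   along the [x l], and [D] converts them to coordinates in [z]. *)
exists (\det (D *m C)); rewrite -det_mulmx -mulmxA.
suff -> : D *m (C *m G) = 1%:M by rewrite det1.
have CG : C *m G = \matrix_(l < n, j < k) theta (y l * z j).
  apply/matrixP => l j; rewrite !mxE (basis_coordE hz (y l)) mulr_suml.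
  rewrite linear_sum; apply: eq_bigr => i _.
  by rewrite !mxE -scalerAl linearZ.
apply/matrixP => p j; rewrite CG -(hom_mx_id hz) !mxE /= -{1}(hsys (z j)).1.
rewrite basis_coord_sum summxE; apply: eq_bigr => l _.
by rewrite !mxE mulrC.
Qed.

End FrobeniusSystem.

Theorem lemma1p8 (R : comPzRingType) (A : algType R) (hA : free_frobenius A)
    (n : nat) (theta : {scalar A}) (x y : 'I_n -> A)
    (hsys : frobenius_system theta x y) (hx : is_basis x)
    (mu : {lrmorphism A -> A}) (hmu : is_nakayama theta mu)
    (m : nat) (b : 'I_m -> A) (hb : is_basis b) :
  let omega := \sum_(i < n) mu (x i) * y i in
  [/\ hs_trace hb =1 form_mulr theta omega,
      forall (k : nat) (z : 'I_k -> A), is_basis z ->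
        eq_up_to_unit (discriminant (hs_trace hb) z) (alg_norm hb omega)
    & normal_element mu omega].
Proof.
move=> omega.
have nak a v : theta (v * a) = theta (mu a * v) by exact: hmu.2.
have trE a : hs_trace hb a = theta (omega * a).
  pose c i : {scalar A} := theta \o (y i \*o idfun).
  have xc v : v = \sum_(i < n) c i v *: x i by rewrite (hsys v).1.
  rewrite /hs_trace (trace_end_mx_dual hb xc (a \*o idfun)).
  rewrite mulr_suml linear_sum; apply: eq_bigr => i _ /=.
  by rewrite mulrA nak mulrA.
split=> [a | k z hz | a]; first exact: trE.
- exists (\det (\matrix_(i < k, j < k) theta (z i * z j))).
    exact: (det_gram_unit hsys hz).
  have -> : alg_norm hb omega = \det (end_mx hz (fun v => omega * v)).
    exact: (det_end_mx hb hz (omega \*o idfun)).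
  (* The coordinates of [omega * z i] form a column of [end_mx], but pair as a row with the Gram
     matrix; hence the transpose. *)
  rewrite mulrC -[\det (end_mx _ _)]det_tr -det_mulmx; congr (\det _).
  apply/matrixP => i j; rewrite !mxE trE mulrA {1}(basis_coordE hz (omega * z i)).
  rewrite mulr_suml linear_sum; apply: eq_bigr => p _.
  by rewrite !mxE -scalerAl linearZ.
- apply: (frobenius_form_inj hsys) => v.
  (* [theta (mu a * omega * v) = theta (omega * v * a) = tr (v * a) = tr (a * v) = theta (omega * a
     * v)]. *)
  by rewrite -mulrA -nak -mulrA -trE hs_traceC trE mulrA.
Qed.
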